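(* Consider the charged-particle dynamics $\ddot x=\dot x\times B(x)+F(x)$ in $\mathbb{R}^3$ with $B=\nabla\times A$ and $F=-\nabla U$, and suppose that for some skew-symmetric matrix $S\in\mathbb{R}^{3\times3}$ $$U(e^{\tau S}x)=U(x),\qquad e^{-\tau S}A(e^{\tau S}x)=A(x)\qquad\text{for all real }\tau\text{ and all }x.$$ Let $(x_n,v_n)$ be the numerical solution obtained with stepsize $h>0$ by the two-step method $$\begin{aligned}x_{n+1}-2x_n+x_{n-1}=&\tfrac h2A'^{\intercal}(x_{n+1/2})(x_{n+1}-x_n)+\tfrac h2A'^{\intercal}(x_{n-1/2})(x_n-x_{n-1})\\&-h\big(A(x_{n+1/2})-A(x_{n-1/2})\big)+\tfrac{h^2}2\big(F(x_{n+1/2})+F(x_{n-1/2})\big),\end{aligned}$$ together with $v_{n+1}=2\frac{x_{n+1}-x_n}h-v_n$, where $x_{n\pm1/2}=\frac{x_n+x_{n\pm1}}2$ and $v_{n+1/2}=\frac{v_n+v_{n+1}}2$. Assume that the numerical solution $(x_n,v_n)$ stays in a compact set that is independent of $h$. Let $N\ge2$ be an arbitrary integer. Then the momentum $M(x,v)=(v+A(x))^{\intercal}Sx$ satisfies $$|M(x_{n+1/2},v_{n+1/2})-M(x_{1/2},v_{1/2})|\le Ch^2\qquad\text{for } nh\le h^{-N},$$ where the constant $C$ is independent of $n$ and $h$ as long as $nh\le h^{-N}$.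
   Context: The method is called TSM2; the setting is a normal magnetic field (scaling parameter $\epsilon=1$). $A:\mathbb{R}^3\to\mathbb{R}^3$ (vector potential) and $U:\mathbb{R}^3\to\mathbb{R}$ (scalar potential) are assumed smooth; $A'(x)$ is the Jacobian matrix of $A$ and $A'^{\intercal}(x)$ its transpose. The initial values $x_0$ and $v_0$ are bounded independently of $h$. $\times$ is the cross product. *)

(* Defs.v *)
From HB Require Import structures.
From mathcomp Require Import all_boot all_order all_algebra.
From mathcomp Require Import all_classical all_reals all_analysis.

Set Implicit Arguments.
Unset Strict Implicit.
Unset Printing Implicit Defensive.

Import Order.TTheory GRing.Theory Num.Theory.
Import numFieldNormedType.Exports.

Local Open Scope classical_set_scope.
Local Open Scope ring_scope.

(* For finite-dimensional V this is the usual C^k: the derivatives along all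
   constant directions v include the partial derivatives. *)
Fixpoint C_k (R : realType) (V W : normedModType R) (k : nat) (f : V -> W)
  : Prop :=
  if k is k'.+1 then
    (forall x, differentiable f x) /\
    (forall v : V, C_k k' (fun x => 'D_v f x))
  else continuous f.

Definition smooth (R : realType) (V W : normedModType R) (f : V -> W) : Prop :=
  forall k, C_k k f.

Definition expmx (R : realType) (n : nat) (M : 'M[R]_n.+1) : 'M[R]_n.+1 :=
  lim (series (fun k => (k`!%:R)^-1 *: M ^+ k) @ \oo).

(* Points of R^3 are column vectors and the Jacobian has the convention
   (A'(x))_ij = dA_i/dx_j; it is the transpose of the row-vector 'J of
   MathComp-Analysis. *)
Definition partial (R : realType) (W : normedModType R)
    (f : 'cV[R]_3 -> W) (j : 'I_3) (x : 'cV[R]_3) : W :=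
  'D_(delta_mx j 0) f x.

Definition jac (R : realType) (A : 'cV[R]_3 -> 'cV[R]_3) (x : 'cV[R]_3)
  : 'M[R]_3 :=
  \matrix_(i, j) (partial A j x) i 0.

Definition grad (R : realType) (U : 'cV[R]_3 -> R) (x : 'cV[R]_3)
  : 'cV[R]_3 :=
  \col_i partial U i x.

(* Indices are cyclic in 'I_3, so i + 1 and i + 2 are taken mod 3. *)
Definition curl (R : realType) (A : 'cV[R]_3 -> 'cV[R]_3) (x : 'cV[R]_3)
  : 'cV[R]_3 :=
  \col_i (jac A x (i + 2) (i + 1) - jac A x (i + 1) (i + 2)).

Definition mid (R : realType) (a b : 'cV[R]_3) : 'cV[R]_3 :=
  2^-1 *: (a + b).

(* The two-step relation is centred at n + 1, so that it holds for every index
   >= 1; the starting value x 1 is left free. *)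
Definition TSM2 (R : realType) (A F : 'cV[R]_3 -> 'cV[R]_3) (h : R)
    (x v : nat -> 'cV[R]_3) : Prop :=
  (forall n : nat,
     let xp := mid (x n.+1) (x n.+2) in
     let xm := mid (x n) (x n.+1) in
     x n.+2 - 2 *: x n.+1 + x n =
       (h / 2) *: ((jac A xp)^T *m (x n.+2 - x n.+1))
     + (h / 2) *: ((jac A xm)^T *m (x n.+1 - x n))
     - h *: (A xp - A xm)
     + (h ^+ 2 / 2) *: (F xp + F xm)) /\
  (forall n : nat, v n.+1 = (2 / h) *: (x n.+1 - x n) - v n).

Definition momentum (R : realType) (A : 'cV[R]_3 -> 'cV[R]_3) (S : 'M[R]_3)
    (x v : 'cV[R]_3) : R :=
  ((v + A x)^T *m S *m x) 0 0.

(* Main.v *)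
Require Import Defs.
From HB Require Import structures.
From mathcomp Require Import all_boot all_order all_algebra.
From mathcomp Require Import all_classical all_reals all_analysis.
From mathcomp Require Import ring.

Set Implicit Arguments.
Unset Strict Implicit.
Unset Printing Implicit Defensive.

Import Order.TTheory GRing.Theory Num.Theory.
Import numFieldNormedType.Exports.

Local Open Scope classical_set_scope.
Local Open Scope ring_scope.

(** The method is variational: with y and w the midpoint position and velocity
of a step, it is the discrete Euler-Lagrange equation of
<<L_h(a, b) = h L((a + b)/2, (b - a)/h)>>, where
<<L(y, w) = |w|^2/2 + A(y).w - U(y)>>.  Splitting the two-step relation at the
grid point x_{n+1} makes this visible: with the generalized force
<<g(y, w) = A'(y)^T w + F(y)>>, the momentum <<w + A(y) + (h/2) g>> at the end
of one step equals the momentum <<w + A(y) - (h/2) g>> at the start of the next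
([TSM2_momentum_balance]).  Since midpoints commute with the linear maps
e^{tS}, L_h inherits the symmetry, and the discrete Noether theorem gives an
invariant that is conserved exactly: the pairing of that momentum with S and
the common grid point <<y + (h/2) w>>, resp. <<y - (h/2) w>>.

Expanding this pairing, the terms of order h are
<<g^T S y + (w + A(y))^T S w>>, and they vanish by the infinitesimal symmetry
([lagr_force_noether]), which is the derivative at t = 0 of the two invariance
hypotheses.  What remains is M(y, w) plus <<(h^2/4) g^T S w>>
([half_step_momentum]), so that this modified momentum takes the same value at
every step ([TSM2_modified_momentum]).  Hence M varies by at most h^2/4 times
the variation of <<g^T S w>>, which is a continuous function of two consecutive
points of the compact set K and so is bounded.

The one analytic ingredient is that t |-> e^{tS} has derivative S at 0.  Each
entry of e^{tS} is a power series in t with infinite radius of convergence, so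
termwise differentiation of real power series yields it
([is_derive_expmx0]). *)

(** * Limits and derivatives of matrix-valued functions *)

Lemma cvg_mx_entry (R : realType) (T : Type) (F : set_system T) {FF : Filter F}
    (m n : nat) (f : T -> 'M[R]_(m, n)) (a : 'M[R]_(m, n)) :
  (forall i j, f t i j @[t --> F] --> a i j) -> f t @[t --> F] --> a.
Proof.
move=> fa; apply/cvg_ballP => e e0.
suff : \forall t \near F, forall i j, ball (a i j) e (f t i j).
  by apply: filterS => t ft; split.
apply: filter_forall => i; apply: filter_forall => j.
by move/cvg_ballP : (fa i j); apply.
Qed.

Lemma continuous_mx_entry (R : realType) (T : topologicalType) (m n : nat)
    (f : T -> 'M[R]_(m, n)) :
  (forall i j, continuous (fun t => f t i j)) -> continuous f.
Proof.
move=> fc t.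
by apply: (@cvg_mx_entry R T (nbhs t)) => i j; exact: fc.
Qed.

Lemma cvg_mulmx (R : realType) (T : Type) (F : set_system T) {FF : Filter F}
    (m n p : nat) (f : T -> 'M[R]_(m, n)) (g : T -> 'M[R]_(n, p))
    (a : 'M[R]_(m, n)) (b : 'M[R]_(n, p)) :
  f t @[t --> F] --> a -> g t @[t --> F] --> b ->
  f t *m g t @[t --> F] --> a *m b.
Proof.
move=> fa gb; apply: cvg_mx_entry => i k; rewrite mxE.
under eq_fun do rewrite mxE.
apply: cvg_big => [|j _]; first exact: add_continuous.
apply: cvgM.
- exact: (cvg_comp _ _ fa (@coord_continuous _ _ _ i j a)).
- exact: (cvg_comp _ _ gb (@coord_continuous _ _ _ j k b)).
Qed.

Lemma continuous_trmx (R : realType) (T : topologicalType) (m n : nat)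
    (f : T -> 'M[R]_(m, n)) :
  continuous f -> continuous (fun t => (f t)^T).
Proof.
move=> fc; apply: continuous_mx_entry => i j t; rewrite /continuous_at mxE.
under eq_fun do rewrite mxE.
exact: (cvg_comp _ _ (fc t) (@coord_continuous _ _ _ j i _)).
Qed.

Lemma is_derive_mxP (R : realType) (V : normedModType R) (m n : nat)
    (f : V -> 'M[R]_(m, n)) (t v : V) (df : 'M[R]_(m, n)) :
  is_derive t v f df <->
  forall i j, is_derive t v (fun s => f s i j) (df i j).
Proof.
split=> [[fd fE] i j|fd].
  apply: DeriveDef; first exact: (derivable_mxP _ _ _).1 fd i j.
  by rewrite -fE derive_mx// mxE.
have fdv : derivable f t v by apply/derivable_mxP => i j; case: (fd i j).
apply: DeriveDef => //; rewrite derive_mx//.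
by apply/matrixP => i j; rewrite mxE; case: (fd i j).
Qed.

Lemma is_derive_mulmx (R : realType) (V : normedModType R) (m n p : nat)
    (f : V -> 'M[R]_(m, n)) (g : V -> 'M[R]_(n, p)) (t v : V)
    (df : 'M[R]_(m, n)) (dg : 'M[R]_(n, p)) :
  is_derive t v f df -> is_derive t v g dg ->
  is_derive t v (fun s => f s *m g s) (df *m g t + f t *m dg).
Proof.
move=> /is_derive_mxP fd /is_derive_mxP gd; apply/is_derive_mxP => i k.
have -> : (fun s => (f s *m g s) i k) =
    \sum_j ((fun s => f s i j) * (fun s => g s j k)).
  by apply/funext => s; rewrite mxE fct_sumE.
apply: is_derive_eq.
rewrite !mxE -big_split/=; apply: eq_bigr => j _.
by rewrite addrC /GRing.scale/= (mulrC (g t j k)).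
Qed.

(** The chain rule with a one-dimensional source: it turns an invariance along
the orbits of e^{tS} into a statement about the differential of f. *)
Lemma is_derive_along_curve (R : realType) (V W : normedModType R) (f : V -> W)
    (c : R -> V) (t : R) (dc : V) :
  differentiable f (c t) -> is_derive t 1 c dc ->
  is_derive t 1 (f \o c) ('d f (c t) dc).
Proof.
move=> df [cd <-]; have cdiff : differentiable c t by apply/derivable1_diffP.
have fc : differentiable (f \o c) t by exact: differentiable_comp.
apply: DeriveDef; first by apply/derivable1_diffP.
by rewrite deriveE// diff_comp//= (deriveE _ cdiff).
Qed.

(** * The matrix exponential near the origin *)

Definition sum_norm_entries (R : realType) (n : nat) (M : 'M[R]_n) : R :=
  \sum_i \sum_j `|M i j|.

Lemma sum_norm_entries_ge0 (R : realType) (n : nat) (M : 'M[R]_n) :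
  0 <= sum_norm_entries M.
Proof. by do 2 (apply: sumr_ge0 => ? _). Qed.

(** The sum of the moduli of all entries is submultiplicative and dominates each
entry, whereas the maximum norm would cost a factor n + 1 at each product. *)
Lemma normr_expmx_entry (R : realType) (n : nat) (M : 'M[R]_n.+1) (k : nat)
    (i j : 'I_n.+1) :
  `|(M ^+ k) i j| <= sum_norm_entries M ^+ k.
Proof.
elim: k i j => [|k IH] i j.
  by rewrite !expr0 mxE; case: (i == j); rewrite ?normr1// normr0.
rewrite exprSr mxE (le_trans (ler_norm_sum _ _ _))//.
apply: (@le_trans _ _ (sum_norm_entries M ^+ k * \sum_l `|M l j|)).
  by rewrite mulr_sumr; apply: ler_sum => l _; rewrite normrM ler_wpM2r.
rewrite exprSr; apply: ler_wpM2l.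
  by rewrite exprn_ge0// sum_norm_entries_ge0.
apply: ler_sum => l _; rewrite (bigD1 j)//= lerDl.
by apply: sumr_ge0.
Qed.

(** The Taylor coefficients of an entry of the m-th derivative of e^{tM}.  The
index m makes the family closed under termwise differentiation. *)
Definition exp_entry_coeff (R : realType) (n : nat) (M : 'M[R]_n.+1)
    (i j : 'I_n.+1) (m k : nat) : R :=
  (M ^+ (k + m)) i j / k`!%:R.

Lemma pseries_diffs_exp_entry (R : realType) (n : nat) (M : 'M[R]_n.+1)
    (i j : 'I_n.+1) (m : nat) :
  pseries_diffs (exp_entry_coeff M i j m) = exp_entry_coeff M i j m.+1.
Proof.
apply/funext => k; rewrite /pseries_diffs /exp_entry_coeff addnS addSn.
rewrite factS natrM invfM mulrCA; congr (_ * _).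
by rewrite mulrA divff ?mul1r// pnatr_eq0.
Qed.

(** Comparison with the exponential series of c|t|, where c is the sum of the
moduli of the entries of M. *)
Lemma is_cvg_pseries_exp_entry (R : realType) (n : nat) (M : 'M[R]_n.+1)
    (i j : 'I_n.+1) (m : nat) (t : R) :
  cvgn (pseries (exp_entry_coeff M i j m) t).
Proof.
apply: normed_cvg.
apply: (@series_le_cvg _ _
  (sum_norm_entries M ^+ m *: exp_coeff (sum_norm_entries M * `|t|)))
  => [k|k|k|].
- exact: normr_ge0.
- rewrite /= mulr_ge0 ?exprn_ge0 ?sum_norm_entries_ge0//.
  by rewrite exp_coeff_ge0// mulr_ge0 ?sum_norm_entries_ge0.
- rewrite [leRHS](_ : _ =
    sum_norm_entries M ^+ m * ((sum_norm_entries M * `|t|) ^+ k / k`!%:R))//.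
  rewrite /= /exp_entry_coeff !normrM normfV normrX normr_nat exprMn.
  rewrite !mulrA -exprD (addnC m) mulrAC.
  by do 2 (rewrite ler_wpM2r ?invr_ge0 ?exprn_ge0//); exact: normr_expmx_entry.
- exact/is_cvg_seriesZ/is_cvg_series_exp_coeff.
Qed.

Lemma expmx_entry (R : realType) (n : nat) (M : 'M[R]_n.+1) (t : R)
    (i j : 'I_n.+1) :
  expmx (t *: M) i j = limn (pseries (exp_entry_coeff M i j 0) t).
Proof.
pose L : 'M[R]_n.+1 :=
  \matrix_(a, b) limn (pseries (exp_entry_coeff M a b 0) t).
suff -> : expmx (t *: M) = L by rewrite mxE.
apply/cvg_lim => //; apply: cvg_mx_entry => a b; rewrite mxE.
have := @is_cvg_pseries_exp_entry R n M a b 0 t.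
apply: cvg_trans; apply: near_eq_cvg; apply: nearW => k.
rewrite /pseries /series/= summxE; apply: eq_bigr => l _.
by rewrite /exp_entry_coeff exprZn !mxE addn0; ring.
Qed.

Lemma expmx0 (R : realType) (n : nat) : expmx (0 : 'M[R]_n.+1) = 1.
Proof.
apply/cvg_lim => //; apply: cvg_near_cst; exists 1%N => // -[//|k] _.
rewrite /series/= big_nat_recl//= expr0 fact0 invr1 scale1r big1 ?addr0//.
by move=> l _; rewrite expr0n scaler0.
Qed.

(** Termwise differentiation needs the convergence of the series and of its
first two derived series at one point beyond 0; the point 1 will do. *)
Lemma is_derive_expmx0 (R : realType) (n : nat) (M : 'M[R]_n.+1) :
  is_derive (0 : R) (1 : R) (fun t : R => expmx (t *: M)) M.
Proof.
apply/is_derive_mxP => i j.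
have -> : (fun t : R => expmx (t *: M) i j) =
    fun t => limn (pseries (exp_entry_coeff M i j 0) t).
  by apply/funext => t; exact: expmx_entry.
have -> : M i j = limn (pseries (pseries_diffs (exp_entry_coeff M i j 0)) 0).
  rewrite pseries_diffs_exp_entry; apply/esym/cvg_lim => //.
  apply: cvg_near_cst; exists 1%N => // -[//|k] _.
  rewrite /pseries /series/= big_nat_recl//= /exp_entry_coeff expr0 fact0.
  rewrite big1 ?addr0 => [|l _]; last by rewrite expr0n mulr0.
  by rewrite divr1 mulr1 expr1.
apply: (@pseries_snd_diffs _ _ 1); rewrite ?pseries_diffs_exp_entry.
- exact: is_cvg_pseries_exp_entry.
- exact: is_cvg_pseries_exp_entry.
- exact: is_cvg_pseries_exp_entry.
- by rewrite normr0 normr1.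
Qed.

(** * The infinitesimal form of the symmetry *)

Lemma diff_jac (R : realType) (A : 'cV[R]_3 -> 'cV[R]_3) (y u : 'cV[R]_3) :
  differentiable A y -> 'd A y u = jac A y *m u.
Proof.
move=> dA; rewrite [in LHS](matrix_sum_delta u) linear_sum/=.
apply/colP => i; rewrite mxE summxE; apply: eq_bigr => j _.
by rewrite big_ord1 linearZ/= mxE mxE /partial deriveE// mulrC.
Qed.

Lemma diff_grad (R : realType) (U : 'cV[R]_3 -> R) (y u : 'cV[R]_3) :
  differentiable U y -> 'd U y u = ((grad U y)^T *m u) 0 0.
Proof.
move=> dU; rewrite [in LHS](matrix_sum_delta u) linear_sum/=.
rewrite mxE; apply: eq_bigr => j _.
by rewrite big_ord1 linearZ/= !mxE /partial deriveE// mulrC.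
Qed.

Lemma is_derive_flow (R : realType) (S : 'M[R]_3) (y : 'cV[R]_3) :
  is_derive (0 : R) (1 : R) (fun t : R => expmx (t *: S) *m y) (S *m y).
Proof.
have := is_derive_mulmx (is_derive_expmx0 S) (is_derive_cst y (0 : R) (1 : R)).
by rewrite mulmx0 addr0.
Qed.

(** Differentiate U(e^{tS} y) = U(y) at t = 0. *)
Lemma grad_invariant (R : realType) (U : 'cV[R]_3 -> R) (S : 'M[R]_3)
    (y : 'cV[R]_3) :
  differentiable U y ->
  (forall t x, U (expmx (t *: S) *m x) = U x) ->
  ((grad U y)^T *m S *m y) 0 0 = 0.
Proof.
move=> dU Uinv; rewrite -mulmxA -diff_grad//.
have flow0 : expmx (0 *: S) *m y = y by rewrite scale0r expmx0 mul1mx.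
have := @is_derive_along_curve _ _ _ U
  (fun t => expmx (t *: S) *m y) 0 (S *m y).
rewrite flow0 => /(_ dU (is_derive_flow S y))[_ <-].
have -> : U \o (fun t => expmx (t *: S) *m y) = cst (U y).
  by apply/funext => t; exact: Uinv.
by rewrite derive_cst.
Qed.

(** Differentiate e^{-tS} A(e^{tS} y) = A(y) at t = 0: the product rule gives
- S A(y) + A'(y) S y = 0. *)
Lemma jac_equivariant (R : realType) (A : 'cV[R]_3 -> 'cV[R]_3) (S : 'M[R]_3)
    (y : 'cV[R]_3) :
  differentiable A y ->
  (forall t x, expmx (- (t *: S)) *m A (expmx (t *: S) *m x) = A x) ->
  jac A y *m S *m y = S *m A y.
Proof.
move=> dA Ainv; rewrite -mulmxA -diff_jac//.
have flow0 : expmx (0 *: S) *m y = y by rewrite scale0r expmx0 mul1mx.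
have := @is_derive_along_curve _ _ _ A
  (fun t => expmx (t *: S) *m y) 0 (S *m y).
rewrite flow0 => /(_ dA (is_derive_flow S y)) dAc.
have := is_derive_mulmx (is_derive_expmx0 (- S)) dAc.
have -> : (fun t => expmx (t *: - S) *m
    (A \o (fun t => expmx (t *: S) *m y)) t) = cst (A y).
  by apply/funext => t; rewrite scalerN; exact: Ainv.
rewrite /= flow0 scale0r expmx0 mul1mx => -[_].
by rewrite derive_cst mulNmx => /esym/eqP; rewrite addrC subr_eq0 => /eqP.
Qed.

(** * Skew-symmetric bilinear forms *)

Definition mxform (R : realType) (n : nat) (S : 'M[R]_n) (a b : 'cV[R]_n) : R :=
  (a^T *m S *m b) 0 0.

Lemma mxformDl (R : realType) (n : nat) (S : 'M[R]_n) (a b c : 'cV[R]_n) :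
  mxform S (a + b) c = mxform S a c + mxform S b c.
Proof. by rewrite /mxform linearD/= !mulmxDl mxE. Qed.

Lemma mxformDr (R : realType) (n : nat) (S : 'M[R]_n) (a b c : 'cV[R]_n) :
  mxform S a (b + c) = mxform S a b + mxform S a c.
Proof. by rewrite /mxform mulmxDr mxE. Qed.

Lemma mxformZl (R : realType) (n : nat) (S : 'M[R]_n) k (a b : 'cV[R]_n) :
  mxform S (k *: a) b = k * mxform S a b.
Proof. by rewrite /mxform linearZ/= -!scalemxAl mxE. Qed.

Lemma mxformZr (R : realType) (n : nat) (S : 'M[R]_n) k (a b : 'cV[R]_n) :
  mxform S a (k *: b) = k * mxform S a b.
Proof. by rewrite /mxform -scalemxAr mxE. Qed.

Lemma mxform_skew (R : realType) (n : nat) (S : 'M[R]_n) (a b : 'cV[R]_n) :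
  S^T = - S -> mxform S a b = - mxform S b a.
Proof.
move=> skewS; rewrite /mxform -[in LHS](trmxK (a^T *m S *m b)) mxE.
by rewrite !trmx_mul trmxK skewS mulNmx mulmxN mulmxA mxE.
Qed.

Lemma mxform_diag (R : realType) (n : nat) (S : 'M[R]_n) (a : 'cV[R]_n) :
  S^T = - S -> mxform S a a = 0.
Proof.
move=> skewS; apply/eqP; rewrite -[_ == 0](mulrn_eq0 _ 2) mulr2n.
by rewrite {1}mxform_skew// addNr.
Qed.

(** * The discrete Noether theorem *)

(** The partial derivative in y of the Lagrangian |w|^2/2 + A(y).w - U(y), for
F = - grad U. *)
Definition lagr_force (R : realType) (A F : 'cV[R]_3 -> 'cV[R]_3)
    (y w : 'cV[R]_3) : 'cV[R]_3 :=
  (jac A y)^T *m w + F y.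

(** The discrete Noether invariant of the method, in midpoint variables. *)
Definition modified_momentum (R : realType) (A F : 'cV[R]_3 -> 'cV[R]_3)
    (S : 'M[R]_3) (h : R) (y w : 'cV[R]_3) : R :=
  momentum A S y w + h ^+ 2 / 4 * mxform S (lagr_force A F y w) w.

(** The infinitesimal symmetry of the Lagrangian along S.  The potential
contributes nothing; w^T A'(y) S y = w^T S A(y) by equivariance, which
cancels A(y)^T S w because S is skew, and w^T S w = 0 for the same reason. *)
Lemma lagr_force_noether (R : realType) (A F : 'cV[R]_3 -> 'cV[R]_3)
    (U : 'cV[R]_3 -> R) (S : 'M[R]_3) (y w : 'cV[R]_3) :
  differentiable A y -> differentiable U y ->
  F y = - grad U y -> S^T = - S ->
  (forall t x, U (expmx (t *: S) *m x) = U x) ->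
  (forall t x, expmx (- (t *: S)) *m A (expmx (t *: S) *m x) = A x) ->
  mxform S (lagr_force A F y w) y + mxform S (w + A y) w = 0.
Proof.
move=> dA dU FE skewS Uinv Ainv; rewrite !mxformDl mxform_diag// add0r.
have -> : mxform S ((jac A y)^T *m w) y = mxform S w (A y).
  rewrite /mxform trmx_mul trmxK -mulmxA -[_ *m jac A y *m _]mulmxA.
  by rewrite [jac A y *m _]mulmxA jac_equivariant// !mulmxA.
have -> : mxform S (F y) y = 0.
  rewrite FE -scaleN1r mxformZl /mxform grad_invariant//.
  by rewrite mulr0.
by rewrite addr0 (mxform_skew w)// addNr.
Qed.

(** For e = h/2 the left side is the Noether pairing at the end of a step, for
e = - h/2 the one at its start.  The terms linear in e cancel by symmetry, so
both are equal to the same quantity, which depends on e only through e^2. *)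
Lemma half_step_momentum (R : realType) (A F : 'cV[R]_3 -> 'cV[R]_3)
    (S : 'M[R]_3) (h e : R) (y w : 'cV[R]_3) :
  mxform S (lagr_force A F y w) y + mxform S (w + A y) w = 0 ->
  e ^+ 2 = h ^+ 2 / 4 ->
  mxform S (w + A y + e *: lagr_force A F y w) (y + e *: w) =
  modified_momentum A F S h y w.
Proof.
move=> noether eE; rewrite /modified_momentum -eE.
rewrite [momentum A S y w](_ : _ = mxform S (w + A y) y)// mxformDr mxformZr.
rewrite (mxformDl _ (w + A y) _ y) (mxformDl _ (w + A y) _ w) !mxformZl.
set f := lagr_force A F y w in noether *.
have -> : mxform S (w + A y) w = - mxform S f y.
  by apply/eqP; rewrite -addr_eq0 addrC noether.
move: (mxform S _ y) (mxform S f y) (mxform S f w) => a b c; ring.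
Qed.

Lemma mid_velocity (R : realType) (h : R) (x v : nat -> 'cV[R]_3) (n : nat) :
  v n.+1 = (2 / h) *: (x n.+1 - x n) - v n ->
  mid (v n) (v n.+1) = h^-1 *: (x n.+1 - x n).
Proof.
move=> ->; rewrite /mid addrC subrK scalerA mulrA mulVf ?pnatr_eq0//.
by rewrite mul1r.
Qed.

(** Each half of the average of the two forces is moved to its own side and
joins the velocity and the potential of its own step. *)
Lemma half_force_split (R : realType) (n : nat) (h : R)
    (w1 w0 a1 a0 g1 g0 f1 f0 : 'cV[R]_n) :
  h != 0 ->
  h *: w1 - h *: w0 = (h / 2) *: (h *: g1) + (h / 2) *: (h *: g0)
    - h *: (a1 - a0) + (h ^+ 2 / 2) *: (f1 + f0) ->
  w1 + a1 - (h / 2) *: (g1 + f1) = w0 + a0 + (h / 2) *: (g0 + f0).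
Proof.
move=> h0 /colP E; apply: (scalerI h0); apply/colP => i.
move: (E i) => /eqP; rewrite !mxE -subr_eq0 => /eqP {}E.
by apply/eqP; rewrite -subr_eq0 -E; apply/eqP; ring.
Qed.

(** The discrete Euler-Lagrange equation at x_{n+1}: the momenta seen from the
step before and from the step after agree. *)
Lemma TSM2_momentum_balance (R : realType) (A F : 'cV[R]_3 -> 'cV[R]_3) (h : R)
    (x v : nat -> 'cV[R]_3) (n : nat) :
  h != 0 -> TSM2 A F h x v ->
  let y k := mid (x k) (x k.+1) in
  let w k := mid (v k) (v k.+1) in
  w n.+1 + A (y n.+1) - (h / 2) *: lagr_force A F (y n.+1) (w n.+1) =
  w n + A (y n) + (h / 2) *: lagr_force A F (y n) (w n).
Proof.
move=> h0 [two_step vel] y w; apply: (half_force_split h0).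
have hw k : h *: w k = x k.+1 - x k.
  by rewrite /w (mid_velocity (vel k)) scalerA mulfV// scale1r.
clearbody w; rewrite 2!(scalemxAr h) !hw -(two_step n).
by apply/colP => i; rewrite !mxE; ring.
Qed.

(** Two consecutive steps share a grid point and, by the momentum balance, the
momentum there; so they share the Noether pairing. *)
Lemma TSM2_modified_momentum (R : realType) (A F : 'cV[R]_3 -> 'cV[R]_3)
    (S : 'M[R]_3) (h : R) (x v : nat -> 'cV[R]_3) (n : nat) :
  (forall y w : 'cV[R]_3,
    mxform S (lagr_force A F y w) y + mxform S (w + A y) w = 0) ->
  h != 0 -> TSM2 A F h x v ->
  modified_momentum A F S h (mid (x n) (x n.+1)) (mid (v n) (v n.+1)) =
  modified_momentum A F S h (mid (x 0%N) (x 1%N)) (mid (v 0%N) (v 1%N)).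
Proof.
move=> noether h0 tsm; elim: n => // n <-.
have balance := TSM2_momentum_balance n h0 tsm.
have [_ vel] := tsm.
have back : mid (x n.+1) (x n.+2) + - (h / 2) *: mid (v n.+1) (v n.+2) = x n.+1.
  rewrite (mid_velocity (vel _)) scalerA mulNr mulrAC divff// mul1r /mid.
  by apply/colP => i; rewrite !mxE; field.
have forth : mid (x n) (x n.+1) + (h / 2) *: mid (v n) (v n.+1) = x n.+1.
  rewrite (mid_velocity (vel _)) scalerA mulrAC divff// mul1r /mid.
  by apply/colP => i; rewrite !mxE; field.
have sqr_half : (h / 2) ^+ 2 = h ^+ 2 / 4 by field.
have sqr_opp_half : (- (h / 2)) ^+ 2 = h ^+ 2 / 4 by rewrite sqrrN.
transitivity (mxform S (mid (v n) (v n.+1) + A (mid (x n) (x n.+1)) + (h / 2) *: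
    lagr_force A F (mid (x n) (x n.+1)) (mid (v n) (v n.+1))) (x n.+1)).
- rewrite -(half_step_momentum (noether _ _) sqr_opp_half) back.
  by rewrite scaleNr balance.
- by rewrite -(half_step_momentum (noether _ _) sqr_half) forth.
Qed.

(** * Boundedness of the correction term *)

Lemma continuous_jac (R : realType) (A : 'cV[R]_3 -> 'cV[R]_3) :
  smooth A -> continuous (jac A).
Proof.
move=> /(_ 1%N)[_ dA]; apply: continuous_mx_entry => i j x.
rewrite /continuous_at mxE.
under eq_fun do rewrite mxE.
exact: (cvg_comp _ _ (dA (delta_mx j 0) x) (@coord_continuous _ _ _ i 0 _)).
Qed.

Lemma continuous_grad (R : realType) (U : 'cV[R]_3 -> R) :
  smooth U -> continuous (grad U).
Proof.
move=> /(_ 1%N)[_ dU]; apply: continuous_mx_entry => i j x.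
rewrite /continuous_at mxE.
under eq_fun do rewrite mxE.
exact: dU.
Qed.

Lemma continuous_mid (R : realType) (T : topologicalType)
    (f g : T -> 'cV[R]_3) :
  continuous f -> continuous g -> continuous (fun t => mid (f t) (g t)).
Proof.
by move=> fc gc t; apply: cvgZl_tmp; exact: (cvgD (fc t) (gc t)).
Qed.

Lemma continuous_lagr_force_form (R : realType) (T : topologicalType)
    (A F : 'cV[R]_3 -> 'cV[R]_3) (S : 'M[R]_3) (y w : T -> 'cV[R]_3) :
  continuous (jac A) -> continuous F -> continuous y -> continuous w ->
  continuous (fun t => mxform S (lagr_force A F (y t) (w t)) (w t)).
Proof.
move=> Ac Fc yc wc t.
have cJ : (jac A (y s))^T @[s --> t] --> (jac A (y t))^T.
  exact: (cvg_comp _ _ (yc t) (@continuous_trmx _ _ _ _ _ Ac (y t))).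
have cg : lagr_force A F (y s) (w s) @[s --> t] --> lagr_force A F (y t) (w t).
  apply: cvgD; first by apply: cvg_mulmx => //; exact: wc.
  exact: (cvg_comp _ _ (yc t) (Fc (y t))).
have trc : continuous (@trmx R 3 1).
  by apply: continuous_trmx => z; exact: cvg_id.
have cgSw : (lagr_force A F (y s) (w s))^T *m S *m w s @[s --> t] -->
    (lagr_force A F (y t) (w t))^T *m S *m w t.
  apply: cvg_mulmx; last exact: wc.
  apply: cvg_mulmx; last exact: cvg_cst.
  exact: (cvg_comp _ _ cg (trc _)).
exact: (cvg_comp _ _ cgSw (@coord_continuous R 1 1 0 0 _)).
Qed.

Lemma compact_bound (R : realType) (T : topologicalType) (f : T -> R)
    (K : set T) :
  continuous f -> compact K -> exists2 B, 0 < B & forall t, K t -> `|f t| <= B.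
Proof.
move=> fc cK.
have /compact_bounded/pinfty_ex_gt0[B B0 fB] : compact (f @` K).
  by apply: continuous_compact => //; exact: continuous_subspaceT.
by exists B => // t Kt; apply: (fB (f t)); exists t.
Qed.

(** * Near-conservation of the momentum *)

Theorem theorem3p6 (R : realType)
    (A : 'cV[R]_3 -> 'cV[R]_3) (U : 'cV[R]_3 -> R)
    (B F : 'cV[R]_3 -> 'cV[R]_3) (S : 'M[R]_3)
    (A_smooth : smooth A) (U_smooth : smooth U)
    (B_def : forall x, B x = curl A x)
    (F_def : forall x, F x = - grad U x)
    (S_skew : S^T = - S)
    (U_inv : forall (t : R) (x : 'cV[R]_3), U (expmx (t *: S) *m x) = U x)
    (A_inv : forall (t : R) (x : 'cV[R]_3),
       expmx (- (t *: S)) *m A (expmx (t *: S) *m x) = A x)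
    (K : set ('cV[R]_3 * 'cV[R]_3)) (K_compact : compact K)
    (N : nat) (N_ge2 : (2 <= N)%N) :
  exists C : R,
    forall (h : R) (x v : nat -> 'cV[R]_3),
      0 < h ->
      TSM2 A F h x v ->
      (forall n, K (x n, v n)) ->
      forall n : nat, n%:R * h <= h ^- N ->
        `| momentum A S (mid (x n) (x n.+1)) (mid (v n) (v n.+1))
           - momentum A S (mid (x 0%N) (x 1%N)) (mid (v 0%N) (v 1%N)) |
        <= C * h ^+ 2.
Proof.
have dA x : differentiable A x by case: (A_smooth 1%N).
have dU x : differentiable U x by case: (U_smooth 1%N).
have noether y w : mxform S (lagr_force A F y w) y + mxform S (w + A y) w = 0.
  exact: (@lagr_force_noether _ A F U).
have cF : continuous F.
  have -> : F = (fun x => - grad U x) by apply/funext.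
  by move=> x; exact: (cvgN (@continuous_grad _ _ U_smooth x)).
(* Only the size of this function matters; a midpoint need not stay in K, but
   it is a continuous function of two points that do, whence the product of K
   with itself below. *)
pose power (p : ('cV[R]_3 * 'cV[R]_3) * ('cV[R]_3 * 'cV[R]_3)) :=
  let w := mid p.1.2 p.2.2 in
  mxform S (lagr_force A F (mid p.1.1 p.2.1) w) w.
have cpower : continuous power.
  have cfst (V W : topologicalType) : continuous (@fst V W).
    by move=> ?; exact: cvg_fst.
  have csnd (V W : topologicalType) : continuous (@snd V W).
    by move=> ?; exact: cvg_snd.
  apply: continuous_lagr_force_form => //; first exact: continuous_jac.
  - apply: continuous_mid => p.
    + by apply: (@continuous_comp _ _ _ fst fst); exact: cfst.
    + by apply: (@continuous_comp _ _ _ snd fst); [exact: csnd|exact: cfst].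
  - apply: continuous_mid => p.
    + by apply: (@continuous_comp _ _ _ fst snd); [exact: cfst|exact: csnd].
    + by apply: (@continuous_comp _ _ _ snd snd); exact: csnd.
have [C C0 powerC] := compact_bound cpower (compact_setX K_compact K_compact).
exists (C / 2) => h x v h0 tsm Kxv n _.
have := TSM2_modified_momentum n noether (lt0r_neq0 h0) tsm.
rewrite /modified_momentum => cons.
have bound k : `|power ((x k, v k), (x k.+1, v k.+1))| <= C.
  by apply: powerC; split; exact: Kxv.
move: (bound n) (bound 0%N) cons; rewrite /power/=.
move: (momentum _ _ _ _) (momentum _ _ _ _) (mxform _ _ _) (mxform _ _ _).
move=> M0 M1 P0 P1 b1 b0 cons.
have -> : M1 - M0 = h ^+ 2 / 4 * (P0 - P1).
  move/eqP: cons; rewrite -subr_eq0 => /eqP cons.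
  by apply/eqP; rewrite -subr_eq0 -cons; apply/eqP; ring.
rewrite normrM ger0_norm ?divr_ge0 ?sqr_ge0//.
(* The factor 1/4 meets two powers, each at most C: whence the constant C/2. *)
have -> : C / 2 * h ^+ 2 = h ^+ 2 / 4 * (C + C) by field.
rewrite ler_wpM2l ?divr_ge0 ?sqr_ge0//.
by rewrite (le_trans (ler_normB _ _))// lerD.
Qed.
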